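(* Subgroups of free groups are free. More precisely, let $F$ be a free group on a set $X$ and let $H$ be a subgroup of $F$. Let $T$ be a Schreier transversal for $H$ in $F$ and let $$B=\{\,tx(\overline{tx})^{-1} \mid (t,x)\in T\times X,\ tx(\overline{tx})^{-1}\neq 1\,\}.$$ Then $H$ is freely generated by $B$ (i.e. $H$ is a free group with basis the subset $B\subseteq H$).
   Context: Elements of the free group $F$ on $X$ are viewed as reduced words over $X\cup X^{-1}$. A right transversal of $H$ in $F$ is a complete set of representatives of the right cosets $Hw$ ($w\in F$), one for each coset. A Schreier transversal for $H\le F$ is a right transversal $T$ of $H$ in $F$ that is closed under taking prefixes (in particular it contains the empty word $1$): if $y_1\cdots y_n\in T$ in reduced form with $y_1,\dots,y_n\in X\cup X^{-1}$, then $y_1\cdots y_i\in T$ for all $i=0,\dots,n-1$. For $w\in F$, $\overline{w}$ denotes the representative in $T$ of the coset $Hw$. *)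

(* Defs.v *)
From mathcomp Require Import all_boot.
From mathcomp Require Import boolp classical_sets.

Set Implicit Arguments.
Unset Strict Implicit.
Unset Printing Implicit Defensive.

Import Algebra.

Local Open Scope group_scope.
Local Open Scope classical_set_scope.

(* Subgroups are represented by their underlying sets in an ambient group, so
   that a map out of the subgroup [H] is a map [phi] out of [G] of which only
   the restriction to [H] matters; likewise only the values on [B] of the map
   [f] to be extended matter. *)
Definition extends_to_morphism (G K : groupType) (H B : set G)
    (f phi : G -> K) : Prop :=
  {in H &, {morph phi : x y / x * y}} /\ {in B, phi =1 f}.

(* [H] is a free group with basis the subset [B]: every map from [B] to a group
   extends to a unique group morphism defined on [H]. *)
Definition freely_generated (G : groupType) (H B : set G) : Prop :=
  [/\ group_closed [in H], B `<=` H &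
      forall (K : groupType) (f : G -> K),
        exists2 phi : G -> K, extends_to_morphism H B f phi &
          forall psi : G -> K,
            extends_to_morphism H B f psi -> {in H, psi =1 phi}].

Definition is_free (G : groupType) (H : set G) : Prop :=
  exists B : set G, freely_generated H B.

Definition right_coset (G : groupType) (H : set G) (w : G) : set G :=
  [set h * w | h in H].

Definition right_transversal (G : groupType) (H T : set G) : Prop :=
  forall w : G, exists! t : G, (T `&` right_coset H w) t.

Definition letters (G : groupType) (X : set G) : set G :=
  X `|` [set x^-1 | x in X].

(* When [G] is free on [X], the map sending a reduced word [s] to the product
   of its letters is a bijection onto [G]; this is how elements of [G] are
   regarded as reduced words. *)
Definition reduced_word (G : groupType) (X : set G) (s : seq G) : Prop :=
  {subset s <= letters X} /\ sorted (fun y z => z != y^-1) s.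

Definition word_value (G : groupType) (s : seq G) : G := \prod_(y <- s) y.

Definition schreier_transversal (G : groupType) (X H T : set G) : Prop :=
  right_transversal H T /\
  forall s : seq G, reduced_word X s -> T (word_value s) ->
    forall i : nat, (i < size s)%N -> T (word_value (take i s)).

(* The default value [1] of [xget] is never used when [T] is a transversal. *)
Definition coset_repr (G : groupType) (H T : set G) (w : G) : G :=
  xget 1 (T `&` right_coset H w).

Definition schreier_generator (G : groupType) (H T : set G) (t x : G) : G :=
  t * x * (coset_repr H T (t * x))^-1.

Definition schreier_basis (G : groupType) (X H T : set G) : set G :=
  [set b | exists t x : G,
     [/\ T t, X x, b = schreier_generator H T t x & b <> 1]].

(* Main.v *)
Require Import Defs.
From HB Require Import structures.
From mathcomp Require Import all_boot.
From mathcomp Require Import boolp classical_sets.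
Import Algebra.
Local Open Scope group_scope.
Local Open Scope classical_set_scope.

(** The proof follows the covering-space picture without building a covering.

    Existence of extensions.  Let [f] map the Schreier generators to a group
    [K].  A morphism on [H] extending [f] is sought as [h |-> c 1 h], where
    [c g w] is to be thought of as the product of labels in [K] read along the
    path spelled by [w] from the coset [H g] in the Schreier graph of [H], the
    edge from [H t] labelled by [x] carrying [f (t x (repr (t x))^-1)], or [1]
    if that generator is trivial.  Such path products are the solutions of the
    cocycle identity [c g (u v) = c g u * c (g u) v].  This identity says
    exactly that [w |-> (c^~ w, w)] is a morphism to the unrestricted wreath
    product of [K] by [F], so the universal property of [F], applied to that
    wreath product, yields a unique cocycle for each assignment of values on
    the letters ([cocycle_exists], [cocycle_unique]).  The Schreier condition
    says that [T] is a spanning tree of the Schreier graph: paths inside [T]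
    only cross edges labelled [1], so [c 1 t = 1] on [T], and therefore [c 1]
    maps every generator [t x (repr (t x))^-1] to the label of its edge.

    Uniqueness.  The element [repr g * w * (repr (g w))^-1] of [H] is itself a
    cocycle in [g] and [w], whose value at [g = 1] and [w = h] in [H] is [h],
    and whose values on letters are Schreier generators or [1].  Two morphisms
    that agree on the generators turn it into two cocycles that agree on
    letters, hence everywhere.

    Freeness of every subgroup.  Both arguments apply to any transversal each
    of whose elements is joined to [1] by a path inside it ([connected_in]).
    Such a transversal is a maximal connected partial transversal, and Zorn's
    lemma provides one.  A Schreier transversal is of this kind because the
    prefixes of a reduced word spell a path to its value. *)

Set Implicit Arguments.
Unset Strict Implicit.
Unset Printing Implicit Defensive.

(** * Cocycles and the wreath product *)

(** The unrestricted wreath product of [K] by [G], where [G] acts on functions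
    [G -> K] by translation of the argument. *)
Definition wreath (G K : groupType) : Type := ((G -> K) * G)%type.

HB.instance Definition _ (G K : groupType) := Choice.on (wreath G K).

Section WreathGroup.

Variables G K : groupType.
Implicit Types a b c : wreath G K.

Definition wreath_mul a b : wreath G K :=
  (fun g => a.1 g * b.1 (g * a.2), a.2 * b.2).
Definition wreath_one : wreath G K := (fun=> 1, 1).
Definition wreath_inv a : wreath G K :=
  (fun g => (a.1 (g * a.2^-1))^-1, a.2^-1).

Lemma wreath_mulA : associative wreath_mul.
Proof.
move=> a b c; rewrite /wreath_mul /= mulgA; congr pair.
by apply/funext => g; rewrite !mulgA.
Qed.

Lemma wreath_mul1 : left_id wreath_one wreath_mul.
Proof.
case=> a u; rewrite /wreath_mul /= mul1g; congr pair.
by apply/funext => g; rewrite mul1g mulg1.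
Qed.

Lemma wreath_1mul : right_id wreath_one wreath_mul.
Proof.
case=> a u; rewrite /wreath_mul /= mulg1; congr pair.
by apply/funext => g; rewrite mulg1.
Qed.

Lemma wreath_mulV : left_inverse wreath_one wreath_inv wreath_mul.
Proof.
case=> a u; rewrite /wreath_mul /wreath_one /= mulVg; congr pair.
by apply/funext => g; rewrite mulVg.
Qed.

Lemma wreath_mulgV : right_inverse wreath_one wreath_inv wreath_mul.
Proof.
case=> a u; rewrite /wreath_mul /wreath_one /= mulgV; congr pair.
by apply/funext => g; rewrite mulgK mulgV.
Qed.

HB.instance Definition _ := isGroup.Build (wreath G K)
  wreath_mulA wreath_mul1 wreath_1mul wreath_mulV wreath_mulgV.

End WreathGroup.

Definition cocycle (G K : groupType) (c : G -> G -> K) : Prop :=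
  forall g u v, c g (u * v) = c g u * c (g * u) v.

Section Cocycle.

Variables (G K : groupType) (c : G -> G -> K).
Hypothesis cocycle_c : cocycle c.

Lemma cocycle1 g : c g 1 = 1.
Proof. by apply: (mulgI (c g 1)); rewrite -{2}[g]mulg1 -cocycle_c !mulg1. Qed.

(** With the wreath product acting as it does, the second component records the
    translation of the base point that the cocycle identity asks for. *)
Lemma cocycle_wreath_morph :
  {morph (fun w => (c^~ w, w) : wreath G K) : u v / u * v}.
Proof.
by move=> u v; congr pair; apply/funext => g; rewrite cocycle_c.
Qed.

End Cocycle.

Section FreeCocycle.

Variables (F : groupType) (X : set F).
Hypothesis freeF : freely_generated [set: F] X.

Lemma free_morph_unique (K : groupType) (phi psi : F -> K) :
    {morph phi : x y / x * y} -> {morph psi : x y / x * y} ->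
  (forall x, X x -> phi x = psi x) -> phi =1 psi.
Proof.
move=> phiM psiM eqX w; have [_ _ univ] := freeF.
have [chi _ uniq] := univ K phi.
rewrite (uniq phi) ?(uniq psi) ?in_setT //; split.
- by move=> x y _ _.
- by move=> x /set_mem /eqX.
- by move=> x y _ _.
- by [].
Qed.

Lemma cocycle_unique (K : groupType) (c d : F -> F -> K) :
    cocycle c -> cocycle d ->
  (forall g x, X x -> c g x = d g x) -> forall g w, c g w = d g w.
Proof.
move=> /cocycle_wreath_morph cM /cocycle_wreath_morph dM eqX g w.
have eq_cd : forall x, X x -> (c^~ x, x) = (d^~ x, x) :> wreath F K.
  by move=> x Xx; congr pair; apply/funext => a; apply: eqX.
by have [/(congr1 (@^~ g))] := free_morph_unique cM dM eq_cd w.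
Qed.

Lemma cocycle_exists (K : groupType) (f : F -> F -> K) :
  exists2 c : F -> F -> K, cocycle c & forall g x, X x -> c g x = f g x.
Proof.
have [_ _ univ] := freeF.
have [phi [phiM phiX] _] :=
  univ (wreath F K) (fun w => (f^~ w, w) : wreath F K).
have{phiX} phiX x : X x -> phi x = (f^~ x, x) by move=> Xx; rewrite phiX ?inE.
have{phiM} phiM : {morph phi : u v / u * v}.
  by move=> u v; apply: phiM; rewrite in_setT.
have snd_phi : snd \o phi =1 id.
  apply: free_morph_unique => [u v|//|x Xx] /=; first by rewrite phiM.
  by rewrite phiX.
exists (fun g w => (phi w).1 g) => [g u v|g x /phiX-> //].
by rewrite phiM /= [X in g * X]snd_phi.
Qed.

(** Otherwise the indicator of [A] would have a nontrivial coboundary that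
    vanishes on the letters, contradicting uniqueness of cocycles. *)
Lemma free_translation_invariant (A : set F) :
  A 1 -> (forall g x, X x -> A (g * x) <-> A g) -> forall w, A w.
Proof.
move=> A1 AX w; apply: contrapT => notAw.
pose a g := if `[< A g >] then 1 else w.
have cob : cocycle (fun g v => (a g)^-1 * a (g * v)).
  by move=> g u v; rewrite !mulgA mulgK.
have triv : cocycle (fun _ _ : F => 1 : F) by move=> g u v; rewrite mulg1.
have /(_ _ 1 w) := cocycle_unique cob triv.
rewrite /a mul1g asboolT // asboolF // invg1 mul1g => w1.
apply: notAw; rewrite w1 // => g x Xx.
by rewrite (asbool_equiv_eq (AX g x Xx)) mulVg.
Qed.

End FreeCocycle.

(** * Paths in the Cayley graph *)

(** The elements joined to [1] by a path of the Cayley graph of [G] with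
    respect to [X], all of whose vertices lie in [T]. *)
Inductive connected_in (G : groupType) (X T : set G) : G -> Prop :=
| connected_in1 : T 1 -> connected_in X T 1
| connected_inM t y : connected_in X T t -> letters X y -> T (t * y) ->
    connected_in X T (t * y).

Section Paths.

Variables (G : groupType) (X : set G).
Implicit Types (T U : set G) (t w y : G).

Lemma connected_in_vertex T t : connected_in X T t -> T t.
Proof. by case. Qed.

Lemma connected_in_one T t : connected_in X T t -> T 1.
Proof. by elim. Qed.

Lemma connected_in_subset T U t :
  T `<=` U -> connected_in X T t -> connected_in X U t.
Proof.
move=> TU; elim=> [T1|{}t y _ IH Xy Tty]; first exact/connected_in1/TU.
exact: connected_inM IH Xy (TU _ Tty).
Qed.

Lemma word_value_rcons (s : seq G) y :
  word_value (rcons s y) = word_value s * y.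
Proof. by rewrite /word_value -cats1 big_cat big_seq1. Qed.

Lemma reduced_word_rcons_inv (s : seq G) y :
  reduced_word X (rcons s y) -> reduced_word X s /\ letters X y.
Proof.
case=> sX red; split; last by apply/set_mem/sX; rewrite mem_rcons mem_head.
split=> [z zs|]; first by apply: sX; rewrite mem_rcons in_cons zs orbT.
by case: s red {sX} => //= z s; rewrite rcons_path => /andP[].
Qed.

(** Appending a letter to a reduced word either leaves it reduced or cancels
    its last letter. *)
Lemma reduced_word_mul_letter (s : seq G) y :
    reduced_word X s -> letters X y ->
  exists2 s', reduced_word X s' & word_value s' = word_value s * y.
Proof.
move=> reds Xy; have [[s' def_s]|nlast] := pselect (exists s', s = rcons s' y^-1).
  exists s'; first by move: reds; rewrite def_s => /reduced_word_rcons_inv[].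
  by rewrite def_s word_value_rcons mulgVK.
exists (rcons s y); last exact: word_value_rcons.
case: reds => sX red; split=> [z|].
  by rewrite mem_rcons in_cons => /predU1P[->|/sX //]; rewrite inE.
case/lastP: s red nlast {sX} => // s z red nlast.
have sorted_rcons2 (e : rel G) :
    sorted e (rcons (rcons s z) y) = sorted e (rcons s z) && e z y.
  by case: s {red nlast} => [|u s] /=; rewrite ?andbT // rcons_path last_rcons.
rewrite sorted_rcons2 red.
by apply/eqP => def_y; apply: nlast; exists s; rewrite def_y invgK.
Qed.

Hypothesis freeG : freely_generated [set: G] X.

Lemma free_connected w : connected_in X setT w.
Proof.
apply: (free_translation_invariant freeG); first exact: connected_in1.
move=> g x Xx; split=> [cgx|cg]; last by apply: connected_inM => //; left.
by rewrite -(mulgK x g); apply: connected_inM => //; right; exists x.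
Qed.

Lemma exists_reduced_word w :
  exists2 s, reduced_word X s & word_value s = w.
Proof.
elim: {w}(free_connected w) => [_|w y _ [s reds <-] Xy _].
  by exists [::]; [split | rewrite /word_value big_nil].
exact: reduced_word_mul_letter.
Qed.

Lemma schreier_transversal_connected (H T : set G) :
  schreier_transversal X H T -> forall t, T t -> connected_in X T t.
Proof.
case=> _ prefT t; have [s + <-] := exists_reduced_word t.
elim/last_ind: s => [_|s y IH red Tsy].
  by rewrite /word_value big_nil; apply: connected_in1.
have [reds Xy] := reduced_word_rcons_inv red.
have := prefT _ red Tsy (size s).
rewrite size_rcons ltnSn -cats1 take_size_cat // cats1 => /(_ isT) Ts.
move: Tsy; rewrite word_value_rcons.
by apply: connected_inM Xy; apply: IH.
Qed.

End Paths.

(** * Connected transversals *)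

Section Subgroup.

Variables (G : groupType) (H : set G).
Hypothesis subgroupH : group_closed [in H].

Lemma subgroup1 : H 1.
Proof. by have [/set_mem] := subgroupH. Qed.

Lemma subgroupV u : H u -> H u^-1.
Proof. by move=> /mem_set /(group_closedV subgroupH)/set_mem. Qed.

Lemma subgroupM u v : H u -> H v -> H (u * v).
Proof.
by move=> /mem_set Hu /mem_set Hv; apply/set_mem/(group_closedM subgroupH).
Qed.

Lemma right_cosetP w t : right_coset H w t <-> H (w / t).
Proof.
split=> [[h Hh <-]|Hwt]; first by rewrite invgM mulVKg; apply: subgroupV.
by exists (t / w); rewrite ?mulgVK // -invgF; apply: subgroupV.
Qed.

(** Zorn's lemma applied to the partial transversals that are connected; a
    maximal one meets every coset, since a missed coset adjacent to a met one
    could be reached by one more letter. *)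
Lemma exists_connected_transversal (X : set G) :
    (forall w, connected_in X setT w) ->
  exists2 T, right_transversal H T & forall t, T t -> connected_in X T t.
Proof.
move=> connG.
pose P A := (forall a b, A a -> A b -> H (a / b) -> a = b)
  /\ (forall a, A a -> connected_in X A a).
have [|A [[injA connA] maxA]] := @Zorn_bigcup _ P.
  move=> C CP totC; split=> [a b [A CA Aa] [B CB Bb]|a [A CA Aa]].
    have [AB|BA] := totC _ _ CA CB.
      by apply: (CP _ CB).1 => //; apply: AB.
    by apply: (CP _ CA).1 => //; apply: BA.
  apply: connected_in_subset (proj2 (CP _ CA) a Aa).
  exact: bigcup_sup.
have meetA u : connected_in X (A `|` [set u]) u -> exists2 a, A a & H (u / a).
  move=> connu; apply: contrapT => missA.
  have nHu a : A a -> ~ H (u / a) by move=> Aa Hua; apply: missA; exists a.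
  apply: (maxA (A `|` [set u])).
    split=> [a Aa|sAu]; first by left.
    apply: missA; exists u; last by rewrite mulgV; apply: subgroup1.
    by apply: sAu; right.
  split=> [a b [Aa|->] [Ab|->] // Hab|a [Aa|-> //]].
  - exact: injA.
  - by case: (nHu a Aa); rewrite -invgF; apply: subgroupV.
  - by case: (nHu b Ab).
  - by apply: connected_in_subset (connA a Aa) => b; left.
have coverA w : exists2 a, A a & H (w / a).
  elim: {w}(connG w) => [_|w y _ [a Aa Hwa] Xy _].
    by apply/meetA/connected_in1; right.
  have [b Ab Hayb] : exists2 b, A b & H (a * y / b).
    apply: meetA; apply: connected_inM => //; last by right.
    by apply: connected_in_subset (connA a Aa) => b; left.
  exists b => //; have := subgroupM Hwa Hayb.
  by rewrite !mulgA mulgVK.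
exists A => // w; have [a Aa Hwa] := coverA w.
exists a; split=> [|b [Ab /right_cosetP Hwb]].
  by split; last exact/right_cosetP.
apply: injA => //; have := subgroupM (subgroupV Hwa) Hwb.
by rewrite invgF mulgA mulgVK.
Qed.

(** * Schreier generators of a connected transversal *)

Variables T : set G.
Hypothesis transT : right_transversal H T.

Local Notation repr := (coset_repr H T).

Lemma coset_reprP w : T (repr w) /\ H (w / repr w).
Proof.
have [t [Tt _]] := transT w.
have [Tr /right_cosetP] := @xgetPex _ 1 (T `&` right_coset H w) (ex_intro _ t Tt).
by [].
Qed.

Lemma coset_repr_eq w t : T t -> H (w / t) -> repr w = t.
Proof.
move=> Tt Hwt; have [Tr Hr] := coset_reprP w.
have [s [_ uniq]] := transT w.
by rewrite -(uniq (repr w)) ?(uniq t) //; split=> //; apply/right_cosetP.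
Qed.

Lemma coset_repr_id t : T t -> repr t = t.
Proof. by move=> Tt; rewrite (coset_repr_eq Tt) // mulgV; apply: subgroup1. Qed.

Lemma coset_reprHM h w : H h -> repr (h * w) = repr w.
Proof.
move=> Hh; have [Tr Hr] := coset_reprP w.
by apply: coset_repr_eq => //; rewrite -mulgA; apply: subgroupM.
Qed.

Lemma coset_reprM g w : repr (repr g * w) = repr (g * w).
Proof.
have [_ Hg] := coset_reprP g.
by rewrite -[in RHS](mulgVK (repr g) g) -[in RHS]mulgA [RHS]coset_reprHM.
Qed.

Lemma schreier_generator_in t w : H (schreier_generator H T t w).
Proof. by have [] := coset_reprP (t * w). Qed.

Lemma schreier_generator1 t y :
  T (t * y) -> schreier_generator H T t y = 1.
Proof. by move=> Tty; rewrite /schreier_generator coset_repr_id // mulgV. Qed.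

(** In a product the factor [(repr (g u))^-1] cancels the next [repr (g u)]. *)
Lemma schreier_generator_cocycle :
  cocycle (fun g w => schreier_generator H T (repr g) w).
Proof.
move=> g u v; rewrite /schreier_generator !coset_reprM.
by rewrite !mulgA mulgVK.
Qed.

End Subgroup.

Section Schreier.

Variables (F : groupType) (X H T : set F).
Hypotheses (freeF : freely_generated [set: F] X)
  (subgroupH : group_closed [in H]) (transT : right_transversal H T)
  (connT : forall t, T t -> connected_in X T t).

Local Notation repr := (coset_repr H T).
Local Notation gen := (schreier_generator H T).

Lemma connected_transversal1 : T 1.
Proof.
have [t [[Tt _] _]] := transT 1.
exact: connected_in_one (connT Tt).
Qed.

Lemma coset_repr_subgroup h : H h -> repr h = 1.
Proof.
move=> Hh; apply: coset_repr_eq => //; first exact: connected_transversal1.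
by rewrite divg1.
Qed.

(** The value through which a morphism on [H] is recovered from the cocycle that
    it induces. *)
Lemma schreier_generator_subgroup h : H h -> gen (repr 1) h = h.
Proof.
move=> Hh; rewrite (coset_repr_subgroup (subgroup1 subgroupH)).
by rewrite /schreier_generator mul1g coset_repr_subgroup // divg1.
Qed.

Lemma morph_subgroup1 (K : groupType) (phi : F -> K) :
  {in H &, {morph phi : x y / x * y}} -> phi 1 = 1.
Proof.
move=> phiM; have H1 := mem_set (subgroup1 subgroupH).
by apply: (mulgI (phi 1)); rewrite -phiM // !mulg1.
Qed.

(** Composing [phi] and [psi] with the cocycle of Schreier generators gives two
    cocycles that agree on letters. *)
Lemma schreier_extension_unique (K : groupType) (f phi psi : F -> K) :
    extends_to_morphism H (schreier_basis X H T) f phi ->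
    extends_to_morphism H (schreier_basis X H T) f psi ->
  {in H, psi =1 phi}.
Proof.
move=> [phiM phiB] [psiM psiB] h /set_mem Hh.
have genH t w : gen t w \in H by apply: mem_set; exact: schreier_generator_in.
have coc chi : {in H &, {morph chi : x y / x * y}} ->
    @cocycle F K (fun g w => chi (gen (repr g) w)).
  by move=> chiM g u v; rewrite schreier_generator_cocycle // chiM.
rewrite -(schreier_generator_subgroup Hh).
apply: (cocycle_unique freeF (coc _ psiM) (coc _ phiM)) => g x Xx.
have [->|gen_neq1] := pselect (gen (repr g) x = 1).
  by rewrite !morph_subgroup1.
have genB : gen (repr g) x \in schreier_basis X H T.
  apply/mem_set; exists (repr g), x; split=> //.
  by have [] := coset_reprP subgroupH transT g.
by rewrite psiB ?phiB.
Qed.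

(** A path inside the spanning tree [T] crosses only edges whose Schreier
    generator is trivial. *)
Lemma cocycle_transversal1 (K : groupType) (c : F -> F -> K) :
    cocycle c ->
    (forall t x, T t -> X x -> gen t x = 1 -> c t x = 1) ->
  forall t, T t -> c 1 t = 1.
Proof.
move=> cM c1 t /connT; elim=> [_|{}t y conn_t IH Xy Tty]; first exact: cocycle1.
have Tt := connected_in_vertex conn_t; rewrite cM IH !mul1g.
have c1T s x : T s -> X x -> T (s * x) -> c s x = 1.
  by move=> Ts Xx /(schreier_generator1 subgroupH transT); apply: c1.
case: Xy Tty => [Xy|[x Xx <-]] Tty; first exact: c1T.
have := cM t x^-1 x; rewrite mulVg cocycle1 // (c1T (t / x)) ?mulg1 //.
by rewrite mulgVK.
Qed.

(** The cocycle with the prescribed labels is multiplicative on [H] because a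
    translation of the base point by [H] does not change its coset. *)
Lemma schreier_extension_exists (K : groupType) (f : F -> K) :
  exists phi : F -> K, extends_to_morphism H (schreier_basis X H T) f phi.
Proof.
pose f1 b := if b == 1 then 1 else f b.
have [c cM cX] := cocycle_exists freeF (fun g x => f1 (gen (repr g) x)).
(* The labels depend only on the coset of the base point, hence so does [c]. *)
have cH h g w : H h -> c (h * g) w = c g w.
  move=> Hh; apply: (cocycle_unique freeF (c := fun g w => c (h * g) w)) => //.
    by move=> a u v; rewrite cM mulgA.
  by move=> a x Xx; rewrite !cX // coset_reprHM.
have cHM h w : H h -> c 1 (h * w) = c 1 h * c 1 w.
  by move=> Hh; rewrite cM mul1g -[h in c h w]mulg1 cH.
have cTX t x : T t -> X x -> c t x = f1 (gen t x).
  by move=> Tt Xx; rewrite cX // (coset_repr_id subgroupH).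
have cT : forall t, T t -> c 1 t = 1.
  apply: cocycle_transversal1 => // t x Tt Xx gen1.
  by rewrite cTX // gen1 /f1 eqxx.
exists (c 1); split=> [u v /set_mem Hu _|b /set_mem[t [x [Tt Xx -> /eqP gen1]]]].
  exact: cHM.
have [Tr _] := coset_reprP subgroupH transT (t * x).
(* Both [c 1 (t * x)] and [c 1] of the generator equal the label of the edge,
   since [c 1] is trivial at [t] and at [repr (t * x)]. *)
rewrite -[LHS]mulg1 -(cT _ Tr) -cHM; last exact: schreier_generator_in.
by rewrite mulgVK cM mul1g cT // mul1g cTX // /f1 (negPf gen1).
Qed.

Lemma connected_transversal_free_basis :
  freely_generated H (schreier_basis X H T).
Proof.
split=> // [b [t [x [_ _ -> _]]]|K f]; first exact: schreier_generator_in.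
have [phi ext_phi] := schreier_extension_exists f.
by exists phi => // psi; apply: schreier_extension_unique.
Qed.

End Schreier.

Unset Implicit Arguments.

Theorem theorem3p2p1 (F : groupType) (X H : set F)
    (freeF : freely_generated [set: F] X) (subgroupH : group_closed [in H]) :
  is_free H /\
  (forall T : set F, schreier_transversal X H T ->
     freely_generated H (schreier_basis X H T)).
Proof.
split=> [|T schT].
  have [T transT connT] :=
    exists_connected_transversal subgroupH (free_connected freeF).
  by exists (schreier_basis X H T); apply: connected_transversal_free_basis.
apply: connected_transversal_free_basis => //; first exact: schT.1.
exact: schreier_transversal_connected freeF _ _ schT.
Qed.
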